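(* Let $r\in(-1,\infty]$. Then for every $K\in\{2,3,\dots\}$ the function $(r+1)^{1/r}M_{r,K}$ is a merging function on $[0,1]^K$, and the family $(r+1)^{1/r}M_{r,K}$, $K=2,3,\dots$, is asymptotically precise. Here $(r+1)^{1/r}$ is understood as $e$ when $r=0$ and as $1$ when $r=\infty$.
   Context: Generalized means on $[0,1]^K$: for $r\in\mathbb{R}\setminus\{0\}$, $M_{r,K}(p_1,\dots,p_K):=\left(\frac{p_1^r+\dots+p_K^r}{K}\right)^{1/r}$, with conventions $0^c:=\infty$ for $c<0$, $0^c:=0$ for $c>0$, $\infty+c:=\infty$, $\infty^c:=0$ for $c<0$; $M_{0,K}(p_1,\dots,p_K):=\left(\prod_{k=1}^K p_k\right)^{1/K}$; $M_{\infty,K}:=\max(p_1,\dots,p_K)$. Fix an atomless probability space and let $\mathcal{U}$ be the set of all random variables on it uniformly distributed on $[0,1]$. A merging function is a Borel function $F:[0,1]^K\to[0,\infty)$, increasing (in the weak sense) in each argument, such that for each $\epsilon\in(0,1)$, $\sup\{\mathbb{P}(F(U_1,\dots,U_K)\le\epsilon)\mid U_1,\dots,U_K\in\mathcal{U}\}\le\epsilon$. A family $F_K$, $K=2,3,\dots$, of merging functions on $[0,1]^K$ is asymptotically precise if for every $a\in(0,1)$ the function $aF_K$ is not a merging function for all large enough $K$ (i.e. there is $K_0$ such that for every $K\ge K_0$, $aF_K$ is not a merging function). *)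

(* Defs.v *)
From HB Require Import structures.
From mathcomp Require Import all_boot all_order all_algebra.
From mathcomp Require Import all_classical all_reals all_analysis.

Set Implicit Arguments.
Unset Strict Implicit.
Unset Printing Implicit Defensive.

Import Order.TTheory GRing.Theory Num.Theory.
Local Open Scope classical_set_scope.
Local Open Scope ring_scope.

(* Power x ^ c for x in [0, +oo] and c != 0. The library's [poweR] is not
   usable here, since it sets 0 ^ c = 0 and +oo ^ c = +oo for c < 0. *)
Definition epow (R : realType) (x : \bar R) (c : R) : \bar R :=
  match x with
  | x'%:E => if (x' == 0) && (c < 0) then +oo%E else (x' `^ c)%:E
  | _ => if c < 0 then 0%E else +oo%E
  end.

(* The mean for a nonzero real exponent, as an extended real: some terms of the
   sum are +oo when r < 0 and some p_k = 0. *)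
Definition epower_mean (R : realType) (r : R) (K : nat) (p : K.-tuple R)
    : \bar R :=
  epow ((\sum_(k < K) epow (tnth p k)%:E r) * (K%:R^-1)%:E)%E r^-1.

(* The maximum starts from 0, which is harmless for entries in [0, 1] and
   K > 0. The value at r = -oo (the minimum) is the usual convention and is
   not relevant below. The [fine] never meets an infinite value on the cube:
   see [epower_mean_fin_num]. *)
Definition gen_mean (R : realType) (r : \bar R) (K : nat) (p : K.-tuple R)
    : R :=
  match r with
  | r'%:E => if r' == 0 then (\prod_(k < K) tnth p k) `^ (K%:R^-1)
             else fine (epower_mean r' p)
  | +oo%E => \big[Num.max/0]_(k < K) tnth p k
  | -oo%E => \big[Num.min/1]_(k < K) tnth p k
  end.

(* (r + 1)^(1/r), understood as e at r = 0 and as 1 at r = +oo *)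
Definition mean_const (R : realType) (r : \bar R) : R :=
  match r with
  | r'%:E => if r' == 0 then expR 1 else (r' + 1) `^ r'^-1
  | _ => 1
  end.

Definition unit_cube (R : realType) (K : nat) : set (K.-tuple R) :=
  [set p | forall k, 0 <= tnth p k <= 1].

Definition atomless (d : measure_display) (T : measurableType d)
    (R : realType) (P : probability T R) : Prop :=
  forall A : set T, measurable A -> (0 < P A)%E ->
    exists B : set T,
      [/\ measurable B, B `<=` A, (0 < P B)%E & (P B < P A)%E].

(* Everywhere [0, 1]-valued, so that functions on [0, 1]^K can be applied to
   K such variables. *)
Definition uniform_rv (d : measure_display) (T : measurableType d)
    (R : realType) (P : probability T R) (U : {RV P >-> R}) : Prop :=
  (forall w, 0 <= U w <= 1) /\
  (forall A : set R, measurable A ->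
     distribution P U A = uniform_prob (@ltr01 R) A).

(* A function on [0, 1]^K is the restriction to [unit_cube] of a total function
   F : K.-tuple R -> R; values of F outside the cube are irrelevant. *)
Definition merging (d : measure_display) (T : measurableType d)
    (R : realType) (P : probability T R) (K : nat) (F : K.-tuple R -> R)
    : Prop :=
  [/\ forall p, unit_cube p -> 0 <= F p,
      measurable_fun (@unit_cube R K) F,
      forall (p q : K.-tuple R) (k : 'I_K), unit_cube p -> unit_cube q ->
        (forall j, j != k -> tnth p j = tnth q j) ->
        tnth p k <= tnth q k -> F p <= F q
    & forall eps : R, 0 < eps < 1 ->
        (ereal_sup [set P [set w | (F [tuple U k w | k < K] <= eps)%R]
                   | U in [set U : 'I_K -> {RV P >-> R} |
                             forall k, uniform_rv (U k)]]
         <= eps%:E)%E].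

(* Only the members F K with K >= 2 of the family matter. *)
Definition asymptotically_precise (d : measure_display)
    (T : measurableType d) (R : realType) (P : probability T R)
    (F : forall K : nat, K.-tuple R -> R) : Prop :=
  forall a : R, 0 < a < 1 ->
    exists K0 : nat, forall K : nat, (2 <= K)%N -> (K0 <= K)%N ->
      ~ merging P (fun p : K.-tuple R => a * F K p).

Section FiniteMean.
Variable R : realType.

Lemma epow_ge0 (x : \bar R) (c : R) : (0 <= epow x c)%E.
Proof.
case: x => [x| |] /=; case: ifP => // _; first by rewrite lee_fin powR_ge0.
Qed.

Lemma epower_mean_fin_num (r : R) (K : nat) (p : K.-tuple R) :
  r != 0 -> (0 < K)%N -> unit_cube p -> epower_mean r p \is a fin_num.
Proof.
move=> r0 K0 p01; rewrite /epower_mean.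
have [rlt0|rge0] := ltP r 0.
  set s := (\sum_(k < K) _)%E.
  have K1 : (0 < (K%:R^-1 : R)%:E)%E by rewrite lte_fin invr_gt0 ltr0n.
  have term_gt0 k : (0 < epow (tnth p k)%:E r)%E.
    rewrite /epow rlt0 andbT; case: eqP => // /eqP pk.
    have /andP[pk0 _] := p01 k.
    by rewrite lte_fin powR_gt0// lt_neqAle eq_sym pk.
  have s_gt0 : (0 < s)%E.
    rewrite /s (bigD1 (Ordinal K0))//.
    by apply: (lt_le_trans (term_gt0 (Ordinal K0))); rewrite leeDl// sume_ge0// => i _;
      exact: epow_ge0.
  have := mule_gt0 s_gt0 K1.
  case: (s * _)%E => [x| |] //=; last by rewrite invr_lt0 rlt0.
  by rewrite lte_fin => x0; rewrite gt_eqF.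
have rgt0 : 0 < r by rewrite lt_neqAle eq_sym r0.
have rN : (r < 0) = false by rewrite ltNge rge0.
have rVN : (r^-1 < 0) = false by rewrite invr_lt0.
under eq_bigr do rewrite /epow rN andbF.
by rewrite sumEFin -EFinM /= rVN andbF.
Qed.

End FiniteMean.

(* Main.v *)
Require Import Defs.
From HB Require Import structures.
From mathcomp Require Import all_boot all_order all_algebra.
From mathcomp Require Import all_classical all_reals all_analysis.
From mathcomp Require Import measurable_realfun ring lra zify.

Set Implicit Arguments.
Unset Strict Implicit.
Unset Printing Implicit Defensive.

Import Order.TTheory GRing.Theory Num.Theory.
Import numFieldNormedType.Exports.
Local Open Scope classical_set_scope.
Local Open Scope ring_scope.

(** Write F_r for (r + 1)^(1/r) M_r.

    F_r is a merging function by linear duality. Suppose that h >= 0 has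
    integral at most e over [0, 1] and that the mean of the h(p_k) is at least 1
    whenever F_r(p) <= e. Then the indicator of {F_r(U) <= e} is at most the
    mean of the h(U_k), whose expectation is at most e, however the U_k depend
    on each other ([prob_le_dual]). For finite nonzero r the function
    h(u) = (r + 1)/r * (1 - (u/e)^r) on ]0, e], extended by 0 above e and by +oo
    at 0, does this; its limit ln(e/u) serves for r = 0, and the indicator of
    [0, e] for r = +oo ([power_mean_bound], [geometric_mean_bound],
    [max_bound]). If r <= 0, h is unbounded near 0, but it has a primitive H
    that is nonnegative on ]0, e] with H(e) = e, and this alone bounds its
    integral by e ([integral_oc_primitive_le]).

    The constant cannot be improved because one coupling makes F_r(U) surely
    smaller than 1 + o(1) as K grows: for a single uniform V take
    U_k = V + k/K modulo 1 ([uniform_rv_grid]). Whatever the value of V, the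
    U_k lie below a rotation of the grid (1/K, 2/K, ..., 1). As F_r is
    increasing and symmetric, F_r(U) is at most F_r(grid), and F_r(grid) tends
    to 1 since the mean of (k/K)^r is a Riemann sum of the integral 1/(r + 1) of
    u^r ([grid_mean]). So for a < 1 and K large, a F_r(U) <= e surely for some
    e < 1, which a merging function forbids.

    It remains to get V from atomlessness ([atomless_uniform_rv]). Every event
    splits into two halves of equal probability ([atomless_halving], a case of
    Sierpinski's theorem on the range of an atomless measure); halving over and
    over gives the binary digits of V. *)

(** * Events of prescribed probability in an atomless space *)

Section atomless_uniform.
Context d (T : measurableType d) (R : realType) (P : probability T R).
Implicit Types A B C D : set T.

Let p A : R := fine (P A).

Let pE A : measurable A -> P A = (p A)%:E.
Proof. by move=> mA; rewrite fineK// fin_num_measure. Qed.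

Let p_le A B : measurable A -> measurable B -> A `<=` B -> p A <= p B.
Proof.
by move=> mA mB AB; rewrite -lee_fin -!pE// le_measure// inE.
Qed.

Let p_ge0 A : 0 <= p A.
Proof. by rewrite fine_ge0. Qed.

Let p_le1 A : measurable A -> p A <= 1.
Proof. by move=> mA; rewrite -lee_fin -pE// probability_le1. Qed.

Let pD A B : measurable A -> measurable B -> B `<=` A ->
  p (A `\` B) = p A - p B.
Proof.
move=> mA mB BA; apply: EFin_inj; rewrite EFinB -!pE//; last exact: measurableD.
by rewrite measureD// ?setIidr// ltey_eq fin_num_measure.
Qed.

Let pU A B : measurable A -> measurable B -> A `&` B = set0 ->
  p (A `|` B) = p A + p B.
Proof.
move=> mA mB AB; apply: EFin_inj; rewrite EFinD -!pE//; last exact: measurableU.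
exact: measureU.
Qed.

Let p0 : p set0 = 0.
Proof. by rewrite /p measure0. Qed.

Hypothesis hP : atomless P.

(** Of an event and its complement in A, the less likely one has at most half
    the probability of A; this can be repeated until the bound [e] is met. *)
Lemma atomless_small_subset A (e : R) : measurable A -> 0 < p A -> 0 < e ->
  exists B, [/\ measurable B, B `<=` A, 0 < p B & p B < e].
Proof.
move=> mA pA e0.
have H n : exists B, [/\ measurable B, B `<=` A, 0 < p B & p B * 2 ^+ n <= 1].
  elim: n => [|n [B [mB BA B0 Bn]]].
    by exists A; split => //; rewrite expr0 mulr1 p_le1.
  have /(hP mB)[C [mC CB]] : (0 < P B)%E by rewrite pE// lte_fin.
  rewrite !pE// !lte_fin => C0 CltB.
  have pBC : p (B `\` C) = p B - p C by rewrite pD.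
  have [CBC|CBC] := leP (p C) (p (B `\` C)).
    exists C; split => //; first exact: subset_trans BA.
    apply: le_trans Bn; rewrite exprS mulrA ler_pM2r ?exprn_gt0//; lra.
  exists (B `\` C); split => //.
  - exact: measurableD.
  - by apply: subset_trans BA => x [].
  - lra.
  - apply: le_trans Bn; rewrite exprS mulrA ler_pM2r ?exprn_gt0//; lra.
have [B [mB BA B0 Bn]] := H (Num.bound e^-1).
exists B; split => //.
have N0 : 0 < 2 ^+ Num.bound e^-1 :> R by rewrite exprn_gt0.
have : e^-1 < 2 ^+ Num.bound e^-1 by exact: upper_nthrootP.
rewrite -(ltr_pM2l e0) divff ?gt_eqF// => eN.
by rewrite -(ltr_pM2r N0) (le_lt_trans Bn).
Qed.

Let admissible A t B C :=
  [/\ measurable C, C `<=` A `\` B & p B + p C <= t].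

(* A piece that is at least half as large as any other makes the greedy
   exhaustion below converge, although a largest piece need not exist. *)
Let half_maximal_piece A t B : measurable B -> B `<=` A -> p B <= t ->
  exists C, admissible A t B C /\
    forall D, admissible A t B D -> p D <= 2 * p C.
Proof.
move=> mB BA Bt.
pose S := [set p D | D in admissible A t B].
have S0 : S 0 by exists set0; rewrite ?p0 //; split => //; rewrite p0 addr0.
have ubS : has_ubound S.
  by exists 1 => _ [D [mD _ _] <-]; exact: p_le1.
have [s0|s0] := leP (sup S) 0.
  exists set0; split; first by split => //; rewrite ?p0 ?addr0.
  move=> D admD; rewrite p0 mulr0 (le_trans _ s0)//.
  by apply: ub_le_sup => //; exists D.
have [||_ [C admC <-] sC] := @sup_adherent R S (sup S / 2).
- by rewrite divr_gt0.
- by split => //; exists 0.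
exists C; split => // D admD.
have : p D <= sup S by apply: ub_le_sup => //; exists D.
lra.
Qed.

(** Sierpinski's theorem. Starting from the empty set, pieces of A are added
    greedily while the probability stays at most [t]. If the union stayed
    strictly below [t], a small event D outside it could have been added at
    every step, so each step would have gained at least half of the probability
    of D, and the total would exceed 1. *)
Lemma atomless_intermediate A t : measurable A -> 0 <= t <= p A ->
  exists B, [/\ measurable B, B `<=` A & p B = t].
Proof.
move=> mA /andP[t0 tA].
have H B : exists C, (measurable B -> B `<=` A -> p B <= t ->
    admissible A t B C /\ forall D, admissible A t B D -> p D <= 2 * p C).
  have [[[mB BA] Bt]|] := pselect ((measurable B /\ B `<=` A) /\ p B <= t).
    by have [C ?] := half_maximal_piece mB BA Bt; exists C.
  by move=> nB; exists set0 => mB BA Bt; exfalso; apply: nB.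
have {H}[c cP] := choice H.
pose F n := iter n (fun B => B `|` c B) set0.
have FS n : F n.+1 = F n `|` c (F n) by [].
have Fok n : [/\ measurable (F n), F n `<=` A & p (F n) <= t].
  elim: n => [|n [mF FA Ft]]; first by split; rewrite /= ?p0.
  have [[mc cA ct] _] := cP _ mF FA Ft.
  rewrite FS; split.
  - exact: measurableU.
  - by move=> x [/FA//|/cA[]].
  - rewrite pU//; apply/seteqP; split => // x [Fx /cA[_]]; exact.
have mF n : measurable (F n) by have [] := Fok n.
have FA n : F n `<=` A by have [] := Fok n.
have Ft n : p (F n) <= t by have [] := Fok n.
have ndF : {homo F : n m / (n <= m)%N >-> (n <= m)%O}.
  apply: homo_leq => // [? ? ?|n]; first exact: le_trans.
  by apply/subsetPset; rewrite FS; exact: subsetUl.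
pose U := \bigcup_n F n.
have mU : measurable U by exact: bigcupT_measurable.
have UA : U `<=` A by move=> x [n _ /FA].
exists U; split => //; apply/eqP; rewrite eq_le; apply/andP; split.
  rewrite -lee_fin -pE//.
  have /cvg_lim <- // := nondecreasing_cvg_mu (mu := P) mF mU ndF.
  apply: lime_le.
    by apply/cvg_ex; exists (P U); exact: nondecreasing_cvg_mu.
  by apply: nearW => n /=; rewrite pE ?lee_fin.
rewrite leNgt; apply/negP => Ut.
have mAU : measurable (A `\` U) by exact: measurableD.
have [||D [mD DAU D0 Dt]] := @atomless_small_subset _ (t - p U) mAU.
- by rewrite pD// subr_gt0 (lt_le_trans Ut).
- by rewrite subr_gt0.
have admD n : admissible A t (F n) D.
  split => //.
    by move=> x /DAU[Ax nUx]; split => // Fx; apply: nUx; exists n.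
  have : p (F n) <= p U by apply: p_le => //; exact: bigcup_sup.
  lra.
have grow n : p D * n%:R <= 2 * p (F n).
  elim: n => [|n IH]; first by rewrite mulr0 p0 mulr0.
  have [[mc cA ct] /(_ _ (admD n)) Dc] := cP _ (mF n) (FA n) (Ft n).
  rewrite FS pU//; last by apply/seteqP; split => // x [Fx /cA[_]]; exact.
  rewrite -natr1 mulrDr mulr1; lra.
have := archi_boundP (divr_ge0 (ler0n R 2) (ltW D0)).
set m := Num.bound _; rewrite ltr_pdivrMr// mulrC.
have := grow m; have := p_le1 (mF m); lra.
Qed.

Lemma atomless_halving A : measurable A ->
  exists B, [/\ measurable B, B `<=` A & p B = p A / 2].
Proof.
move=> mA; apply: atomless_intermediate => //.
by have := p_ge0 A; lra.
Qed.

End atomless_uniform.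

(** * Uniform variables and their distribution function *)

Section uniform_cdf.
Context d (T : measurableType d) (R : realType) (P : probability T R).

(** The uniform distribution lives on the Borel space generated by half-open
    intervals, which has the same measurable sets as [R] but is a different
    measurable type; viewing [U] as a map into it makes the distribution of [U]
    and the uniform one measures on the same space. *)
Definition borel_rv (U : {RV P >-> R}) : T -> measurableTypeR R := U.

Let measurable_borel_rv (U : {RV P >-> R}) : measurable_fun setT (borel_rv U).
Proof. exact: (@measurable_funPT _ _ _ _ U). Qed.

HB.instance Definition _ (U : {RV P >-> R}) :=
  @isMeasurableFun.Build _ _ _ _ (borel_rv U) (measurable_borel_rv U).

Lemma uniform_prob_itvNy (x : R) : 0 <= x <= 1 ->
  uniform_prob (@ltr01 R) `]-oo, x[ = x%:E.
Proof.
move=> /andP[x0 x1].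
rewrite /uniform_prob integral_uniform_pdf.
rewrite (eq_integral (fun=> 1%E)); last first.
  move=> y; rewrite inE/= => -[_]; rewrite in_itv/= /uniform_pdf => ->.
  by rewrite subr0 invr1.
have -> : `]-oo, x[ `&` `[0, 1] = `[0, x[%classic :> set R.
  apply/seteqP; split => y /=; rewrite !in_itv/=.
    by move=> [-> /andP[->]].
  by move=> /andP[-> yx]; split => //; rewrite (le_trans (ltW yx)).
rewrite integral_cst//= mul1e lebesgue_measure_itv/= lte_fin.
by case: ltP => [_|]; [rewrite oppr0 adde0|move=> x0'; congr EFin; lra].
Qed.

(** The rays ]-oo, x[ generate the Borel sets and are stable under
    intersection. *)
Lemma uniform_rv_cdf (U : {RV P >-> R}) : (forall w, 0 <= U w <= 1) ->
  (forall x : R, 0 <= x <= 1 -> P [set w | U w < x] = x%:E) -> uniform_rv U.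
Proof.
move=> U01 Ux; split => // A mA.
pose G := @RGenInftyO.G R.
have GU x : distribution P U `]-oo, x[ = uniform_prob (@ltr01 R) `]-oo, x[.
  rewrite /distribution /pushforward.
  have -> : U @^-1` `]-oo, x[ = [set w | U w < x].
    by apply/seteqP; split => w /=; rewrite in_itv.
  have [x0|x0] := ltP x 0.
    have -> : [set w | U w < x] = set0.
      by apply/seteqP; split => w //= ?; have /andP[? _] := U01 w; lra.
    rewrite measure0; apply/esym/eqP; rewrite -measure_le0.
    rewrite -[leRHS]/((0 : R)%:E) -(@uniform_prob_itvNy 0) ?lexx ?ler01//.
    rewrite le_measure ?inE//= => y /=; rewrite !in_itv/=; lra.
  have [x1|x1] := leP x 1; first by rewrite Ux ?x0// uniform_prob_itvNy ?x0.
  have -> : [set w | U w < x] = setT.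
    by apply/seteqP; split => w //= _; have /andP[_ ?] := U01 w; lra.
  rewrite probability_setT; apply/esym/eqP; rewrite eq_le probability_le1//=.
  rewrite -[leLHS]/((1 : R)%:E) -(@uniform_prob_itvNy 1) ?lexx ?ler01//.
  rewrite le_measure ?inE//= => y /=; rewrite !in_itv/=; lra.
have Gcover : \bigcup_n `]-oo, n%:R[%classic = [set: R].
  apply/seteqP; split => // x _; exists (Num.bound `|x|) => //=.
  by rewrite in_itv/= (le_lt_trans (ler_norm x))// archi_boundP.
apply: (@measure_unique _ R (measurableTypeR R) G
  (fun n => `]-oo, n%:R[%classic) _ _ _ Gcover
  (distribution P (borel_rv U)) (uniform_prob (@ltr01 R))) => //.
- exact: RGenInftyO.measurableE.
- move=> _ _ [x ->] [y ->]; exists (Num.min x y).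
  apply/seteqP; split => z /=; rewrite !in_itv/= lt_min.
    by move=> [-> ->].
  by move=> /andP[].
- by move=> i; exists i%:R; reflexivity.
- by move=> _ [x ->]; exact: GU.
- by move=> k; rewrite ltey_eq fin_num_measure.
Qed.

Lemma uniform_rv_itv (U : {RV P >-> R}) (a b : R) : uniform_rv U ->
  0 <= a -> a <= b -> b <= 1 -> P [set w | a <= U w < b] = (b - a)%:E.
Proof.
move=> [_ Uu] a0 ab b1.
have -> : [set w | a <= U w < b] = U @^-1` `]-oo, b[ `\` U @^-1` `]-oo, a[.
  apply/seteqP; split => w /=; rewrite !in_itv/=.
    by move=> /andP[aU ->]; split => //; apply/negP; rewrite -leNgt.
  by move=> [-> /negP]; rewrite -leNgt => ->.
have mU c : measurable (U @^-1` `]-oo, c[) by exact: measurable_funPTI.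
rewrite measureD ?ltey_eq ?fin_num_measure//.
rewrite setIidr; last by move=> w /=; rewrite !in_itv/=; lra.
rewrite -[LHS]/(distribution P U `]-oo, b[ - distribution P U `]-oo, a[)%E.
by rewrite !Uu// !uniform_prob_itvNy ?EFinB//; lra.
Qed.

End uniform_cdf.

(** * A uniform variable on an atomless space *)

Section uniform_exists.
Context d (T : measurableType d) (R : realType) (P : probability T R).
(** [ind n w] is the integer whose binary digits are the first n digits of the
    point V(w) under construction. The dyadic approximations [ind n w / 2 ^ n]
    increase to V(w) within [2 ^- n], so that the probability of {V < x} differs
    from x by at most [2 * 2 ^- n], for every n. *)
Lemma uniform_rv_of_cells (ind : nat -> T -> nat) :
  (forall n k, measurable (ind n @^-1` [set k])) ->
  (forall n w, (ind n w < 2 ^ n)%N) ->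
  (forall n w, (ind n.+1 w)./2 = ind n w) ->
  (forall n k, (k < 2 ^ n)%N -> P (ind n @^-1` [set k]) = (2 ^- n)%:E) ->
  exists V : {RV P >-> R}, uniform_rv V.
Proof.
move=> mind ind_lt ind_half Pind.
pose v n w : R := (ind n w)%:R / 2 ^+ n.
have p2 n : 0 < 2 ^+ n :> R by rewrite exprn_gt0.
have vS n w : v n w <= v n.+1 w /\ v n.+1 w + 2 ^- n.+1 <= v n w + 2 ^- n.
  rewrite /v -(ind_half n w) -[in X in _ <= X](odd_double_half (ind n.+1 w)).
  rewrite -[in X in X + _](odd_double_half (ind n.+1 w)).
  have i0 : 2 ^+ n != 0 :> R by rewrite gt_eqF.
  set h := (ind n.+1 w)./2; set b := odd _.
  have b01 : 0 <= ((b : nat)%:R : R) <= 1 by rewrite ler0n lern1; case: (b).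
  have e0 : 0 < 2 ^- n.+1 :> R by rewrite invr_gt0.
  have -> : 2 ^- n = 2 * 2 ^- n.+1 :> R by rewrite exprS; field.
  rewrite natrD -muln2 natrM; split; nra.
have nd w : nondecreasing_seq (v ^~ w).
  by apply/nondecreasing_seqP => n; have [] := vS n w.
have vm w n m : (n <= m)%N -> v m w + 2 ^- m <= v n w + 2 ^- n.
  apply: (@homo_leq _ (fun n => v n w + 2 ^- n) (fun x y => y <= x)) => //.
    by move=> y x z xy yz; exact: le_trans yz xy.
  by move=> k; have [] := vS k w.
have v1 w n : v n w <= 1.
  by rewrite /v ler_pdivrMr// mul1r -natrX ler_nat ltnW.
have ub w n : ubound (range (v ^~ w)) (v n w + 2 ^- n).
  move=> _ [m _ <-].
  have [nm|/ltnW mn] := leqP n m.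
    by apply: le_trans (vm w _ _ nm); rewrite lerDl invr_ge0 ltW.
  by apply: le_trans (nd w _ _ mn) _; rewrite lerDl invr_ge0 ltW.
pose V w := sup (range (v ^~ w)).
have ne w : range (v ^~ w) !=set0 by exists (v 0%N w); exists 0%N.
have vV n w : v n w <= V w.
  by apply: ub_le_sup; [exists 1 => _ [m _ <-]|exists n].
have Vv n w : V w <= v n w + 2 ^- n by apply: ge_sup.
have mv n : measurable_fun setT (v n).
  apply: measurable_funM => //.
  apply: (measurableT_comp (f := fun k : nat => k%:R : R)) => //.
  move=> _ Y _; rewrite setTI.
  have -> : ind n @^-1` Y = \bigcup_(k in Y) ind n @^-1` [set k].
    apply/seteqP; split => w /=; first by exists (ind n w).
    by move=> [k Yk /= ->].
  by apply: bigcup_measurable.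
have mV : measurable_fun setT V.
  apply: (measurable_fun_cvg (h := v)) => // w _.
  by apply: nondecreasing_cvgn => //; exists 1 => _ [m _ <-].
pose VR : {RV P >-> R} := HB.pack V (isMeasurableFun.Build _ _ _ _ V mV).
exists VR; apply: uniform_rv_cdf => [w|x /andP[x0 x1]].
  by rewrite (le_trans _ (vV 0%N w)) ?divr_ge0//= ge_sup// => _ [m _ <-].
have mlt n k : measurable [set w | (ind n w < k)%N].
  have -> : [set w | (ind n w < k)%N] = \bigcup_(j in `I_k) ind n @^-1` [set j].
    apply/seteqP; split => w /=; first by exists (ind n w).
    by move=> [j jk /= ->].
  by apply: bigcup_measurable.
have Plt n k : (k <= 2 ^ n)%N ->
    P [set w | (ind n w < k)%N] = (k%:R / 2 ^+ n)%:E.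
  elim: k => [_|k IH kn].
    by rewrite mul0r (_ : [set _ | _] = set0) ?measure0//; apply/seteqP; split.
  have -> : [set w | (ind n w < k.+1)%N] =
      [set w | (ind n w < k)%N] `|` ind n @^-1` [set k].
    apply/seteqP; split => w /=.
      by rewrite ltnS leq_eqVlt => /orP[/eqP|]; [right|left].
    by move=> [/ltnW|->].
  rewrite measureU//; last first.
    by apply/seteqP; split => // w /= [+ E]; rewrite E ltnn.
  rewrite -[LHS]/(P [set w | (ind n w < k)%N] + P (ind n @^-1` [set k]))%E.
  by rewrite IH 1?ltnW// Pind// -EFinD -[k.+1%:R]natr1 mulrDl mul1r.
have mVx : measurable [set w | VR w < x].
  rewrite [X in measurable X](_ : _ = VR @^-1` `]-oo, x[).
    exact: measurable_funPTI.
  by apply/seteqP; split => w /=; rewrite in_itv.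
pose y : R := fine (P [set w | (VR w < x)%R]).
have PVx : P [set w | (VR w < x)%R] = y%:E by rewrite fineK// fin_num_measure.
rewrite PVx; congr EFin.
suff close n : x - 2 * 2 ^- n <= y <= x + 2 * 2 ^- n.
  apply/eqP/contraT => yx.
  have e0 : 0 < `|y - x| by rewrite normr_gt0 subr_eq0.
  have := @upper_nthrootP R (2 / `|y - x|) _ (leqnn _).
  set n := Num.bound _.
  rewrite ltr_pdivrMr// => H; have := close n.
  by rewrite -ler_distl leNgt ltr_pdivrMr// mulrC H.
set m := Num.trunc (2 ^+ n * x).
have mx0 : 0 <= 2 ^+ n * x by rewrite mulr_ge0// ltW.
have /andP[mx xm] := truncn_itv mx0.
rewrite -/m in mx xm.
have m2 : (m <= 2 ^ n)%N.
  by rewrite -(ler_nat R) natrX (le_trans mx)// ger_pMr.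
have e0 : 0 < 2 ^- n :> R by rewrite invr_gt0.
have xm1 : x <= m%:R / 2 ^+ n + 2 ^- n.
  by rewrite -[X in _ + X]mul1r -mulrDl natr1 ler_pdivlMr// mulrC ltW.
apply/andP; split.
  (* {ind n < m - 1} rather than {ind n < m}: V may reach its upper bound
     (ind n + 1) / 2 ^ n, and V < x is strict. *)
  have [m1|m1] := leqP m 1.
    have y0 : 0 <= y by rewrite fine_ge0.
    have : m%:R / 2 ^+ n <= 2 ^- n :> R.
      by rewrite ler_piMl ?lern1 ?ltW.
    lra.
  have : (P [set w | (ind n w < m.-1)%N] <= P [set w | (VR w < x)%R])%E.
    rewrite le_measure ?inE// => w /= iw.
    apply: le_lt_trans (Vv n w) _.
    rewrite /v -[X in _ + X]mul1r -mulrDl natr1 ltr_pdivrMr//.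
    rewrite [x * _]mulrC (lt_le_trans _ mx)//.
    by rewrite ltr_nat; lia.
  rewrite PVx Plt; last by lia.
  rewrite lee_fin; have -> : m.-1%:R = m%:R - 1 :> R.
    by rewrite -subn1 natrB// ltnW.
  by rewrite mulrBl; lra.
have [m1|m1] := ltnP m (2 ^ n).
  have : (P [set w | (VR w < x)%R] <= P [set w | (ind n w < m.+1)%N])%E.
    rewrite le_measure ?inE// => w /= Vx.
    rewrite -(ltr_nat R) (le_lt_trans _ xm)//.
    by rewrite mulrC -ler_pdivrMr// (le_trans (vV n w))// ltW.
  rewrite PVx Plt// lee_fin -[m.+1%:R]natr1 mulrDl mul1r => /le_trans; apply.
  have : m%:R / 2 ^+ n <= x by rewrite ler_pdivrMr// mulrC.
  lra.
have : 1 <= x.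
  by rewrite -(ler_pM2l (p2 n)) mulr1 (le_trans _ mx)// -natrX ler_nat.
have : y <= 1 by rewrite -lee_fin -PVx probability_le1.
lra.
Qed.

Lemma atomless_uniform_rv : atomless P ->
  exists V : {RV P >-> R}, uniform_rv V.
Proof.
move=> hP.
have H A : exists B, measurable A ->
    [/\ measurable B, B `<=` A & fine (P B) = fine (P A) / 2].
  have [mA|nA] := pselect (measurable A); last by exists set0.
  by have [B ?] := atomless_halving hP mA; exists B.
have {H}[h hh] := choice H.
(* The next digit of w is 1 when w lies in the chosen half of its cell. *)
pose step (f : T -> nat) w := ((f w).*2 + `[< h (f @^-1` [set f w]) w >])%N.
pose ind n := iter n step (fun=> 0%N).
have ind_half n w : (ind n.+1 w)./2 = ind n w.
  by rewrite /ind iterS -/(ind n) /step addnC half_bit_double.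
have odd_ind n w : odd (ind n.+1 w) = `[< h (ind n @^-1` [set ind n w]) w >].
  by rewrite /ind iterS -/(ind n) /step oddD odd_double /= oddb.
have cellS n k : measurable (ind n @^-1` [set k./2]) ->
    ind n.+1 @^-1` [set k] = if odd k then h (ind n @^-1` [set k./2])
      else ind n @^-1` [set k./2] `\` h (ind n @^-1` [set k./2]).
  move=> mk; have [_ hsub _] := hh _ mk.
  apply/seteqP; split => w /=.
    by move=> <-; rewrite odd_ind ind_half; case: asboolP.
  move=> kw; have ik : ind n w = k./2.
    by move: kw; case: ifP => _; [move=> /hsub|move=> []].
  rewrite -[LHS]odd_double_half -[RHS]odd_double_half odd_ind ind_half ik.
  congr (_ + _)%N; congr (nat_of_bool _); move: kw; case: ifP => _.
    by move=> kw; rewrite asboolT.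
  by move=> [_ kw]; rewrite asboolF.
have mind n k : measurable (ind n @^-1` [set k]).
  elim: n k => [|n IH] k.
    have [->|k0] := eqVneq k 0%N.
      by rewrite (_ : _ @^-1` _ = setT)//; apply/seteqP; split.
    rewrite (_ : _ @^-1` _ = set0)//; apply/seteqP; split => // w /= k0'.
    by rewrite -k0' eqxx in k0.
  have [mh _ _] := hh _ (IH k./2).
  by rewrite cellS//; case: ifP => _ //; exact: measurableD.
apply: (uniform_rv_of_cells mind _ ind_half).
  move=> n w; elim: n => [//|n IH].
  by move: IH; rewrite expnS -(ind_half n w); lia.
elim=> [|n IH] k.
  rewrite expn0 ltnS leqn0 => /eqP ->.
  rewrite (_ : _ @^-1` _ = setT) ?probability_setT ?expr0 ?invr1//.
  by apply/seteqP; split.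
rewrite expnS => kn; have k2 : (k./2 < 2 ^ n)%N by lia.
have [mh hsub hP2] := hh _ (mind n k./2).
have Ph : P (h (ind n @^-1` [set k./2])) = (2 ^- n.+1)%:E.
  by rewrite -(fineK (fin_num_measure P _ mh)) hP2 IH//= exprS invfM mulrC.
rewrite cellS//; case: ifP => _ //.
rewrite measureD ?ltey_eq ?fin_num_measure// setIidr//.
rewrite -[LHS]/(P (ind n @^-1` [set k./2])
  - P (h (ind n @^-1` [set k./2])))%E.
rewrite IH// Ph -EFinB exprS; congr EFin.
by field; rewrite expf_neq0.
Qed.

End uniform_exists.

(** * Rotations of a uniform variable *)

Lemma uniform_rv_shift d (T : measurableType d) (R : realType)
    (P : probability T R) (V : {RV P >-> R}) (c : R) :
  uniform_rv V -> 0 <= c < 1 ->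
  exists2 U : {RV P >-> R}, uniform_rv U &
    forall w, U w = if V w + c < 1 then V w + c else V w + c - 1.
Proof.
move=> uV /andP[c0 c1]; have [V01 _] := uV.
pose u w := if V w + c < 1 then V w + c else V w + c - 1.
have mVc : measurable_fun setT (fun w => V w + c).
  by apply: measurable_funD => //; exact: measurable_funPT.
have mu : measurable_fun setT u.
  apply: measurable_fun_ifT => //.
  - exact: measurable_fun_ltr.
  - exact: measurable_funB.
pose U : {RV P >-> R} := HB.pack u (isMeasurableFun.Build _ _ _ _ u mu).
exists U => //; apply: uniform_rv_cdf => [w|x /andP[x0 x1]].
  by rewrite /= /u; have := V01 w; case: (ltP (V w + c) 1); lra.
have [xc|cx] := leP x c.
  have -> : [set w | U w < x] = [set w | 1 - c <= V w < x + (1 - c)].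
    apply/seteqP; split => w; rewrite /= /u; have /andP[? ?] := V01 w;
      have [?|?] := ltP (V w + c) 1.
    + by move=> ?; apply/andP; split; lra.
    + by move=> ?; apply/andP; split; lra.
    + by move=> /andP[]; lra.
    + by move=> /andP[]; lra.
  by rewrite uniform_rv_itv ?addrK//; lra.
have mE : measurable [set w | x - c <= V w < 1 - c].
  rewrite [X in measurable X](_ : _ = V @^-1` `[x - c, 1 - c[).
    exact: measurable_funPTI.
  by apply/seteqP; split => w /=; rewrite in_itv.
have -> : [set w | U w < x] = ~` [set w | x - c <= V w < 1 - c].
  apply/seteqP; split => w; rewrite /= /u; have /andP[? ?] := V01 w;
    have [?|?] := ltP (V w + c) 1.
  - by move=> ? /andP[]; lra.
  - by move=> ? /andP[]; lra.
  - move=> H; rewrite ltNge; apply/negP => ?; apply: H.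
    by apply/andP; split; lra.
  - by move=> H; lra.
rewrite probability_setC// uniform_rv_itv//; [|lra|lra|lra].
by rewrite -EFinB; congr EFin; lra.
Qed.

(** With m the integer part of (n + 1) V, the rotated values V + k/(n + 1) mod 1
    fall in the cells of the regular subdivision numbered m + k modulo n + 1;
    the right ends of these cells are the bounds stated here. *)
Lemma uniform_rv_grid d (T : measurableType d) (R : realType)
    (P : probability T R) (V : {RV P >-> R}) (n : nat) : uniform_rv V ->
  exists2 U : 'I_n.+1 -> {RV P >-> R}, forall k, uniform_rv (U k) &
    forall w, exists m : 'I_n.+1,
      forall k, U k w <= ((m + k)%R : 'I_n.+1).+1%:R / n.+1%:R.
Proof.
move=> uV; have [V01 _] := uV.
have n0 : 0 < n.+1%:R :> R by rewrite ltr0n.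
have H (k : 'I_n.+1) : exists U : {RV P >-> R}, uniform_rv U /\
    forall w, U w = let x := V w + k%:R / n.+1%:R in if x < 1 then x else x - 1.
  have [|U uU UE] := @uniform_rv_shift _ _ _ _ V (k%:R / n.+1%:R) uV.
    by rewrite divr_ge0//= ltr_pdivrMr// mul1r ltr_nat.
  by exists U.
have [U UP] := choice H.
exists U => [k|w]; first by have [] := UP k.
have /andP[v0 v1] := V01 w.
have mv0 : 0 <= n.+1%:R * V w by rewrite mulr_ge0.
pose m := Num.trunc (n.+1%:R * V w).
have /andP[mx xm] := truncn_itv mv0; rewrite -/m in mx xm.
have mn : (m <= n.+1)%N.
  by rewrite -(ler_nat R) (le_trans mx)// ger_pMr.
exists (inZp m) => k.
have [_ ->] := UP k.
have -> : nat_of_ord (inZp m + k : 'I_n.+1) = ((m + k) %% n.+1)%N.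
  by rewrite /= modnDml.
rewrite ler_pdivlMr//=.
have E : (V w + k%:R / n.+1%:R) * n.+1%:R = n.+1%:R * V w + k%:R.
  by rewrite mulrDl divfK ?gt_eqF// mulrC.
have kn := ltn_ord k.
case: ltP => [lt1|ge1].
  rewrite E; have : (m + k < n.+1)%N.
    rewrite -(ltr_nat R) natrD.
    rewrite (le_lt_trans _ (_ : (V w + k%:R / n.+1%:R) * n.+1%:R < _))//.
      by rewrite E lerD2r.
    by rewrite gtr_pMl.
  by move/modn_small ->; rewrite -addSn natrD lerD2r ltW.
have mkn : (n.+1 <= m + k)%N.
  rewrite -ltnS -addSn -(ltr_nat R) natrD.
  have : n.+1%:R <= (V w + k%:R / n.+1%:R) * n.+1%:R by rewrite ler_pMl.
  by rewrite E => /le_lt_trans; apply; rewrite ltrD2r.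
rewrite -[(m + k)%N](subnK mkn) modnDr modn_small; last by lia.
rewrite mulrBl E mul1r -subSn// -addSn natrB; last by lia.
by rewrite natrD lerD2r lerD2r ltW.
Qed.

(** * Closed forms of the means, and their values on a regular grid *)

Section means.
Variable R : realType.
Implicit Types (r a x y : R) (K n : nat).

Lemma powR_lt0_le r (x y : R) : r < 0 -> 0 < x -> x <= y -> y `^ r <= x `^ r.
Proof.
move=> r0 x0 xy; have y0 := lt_le_trans x0 xy.
rewrite -[r]opprK !(powRN _ (- r)) lef_pV2 ?posrE ?powR_gt0//.
by apply: ge0_ler_powR; rewrite ?nnegrE ?oppr_ge0//; exact: ltW.
Qed.

Lemma powR_lt0_lt r (x y : R) : r < 0 -> 0 < x -> x < y -> y `^ r < x `^ r.
Proof.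
move=> r0 x0 xy; have y0 := lt_trans x0 xy.
rewrite -[r]opprK !(powRN _ (- r)) ltf_pV2 ?posrE ?powR_gt0//.
by apply: gt0_ltr_powR; rewrite ?nnegrE ?oppr_gt0//; exact: ltW.
Qed.

Lemma powR_div_le (r x y : R) : r != 0 -> 0 < x -> x <= y ->
  x `^ r / r <= y `^ r / r.
Proof.
move=> rn0 x0 xy; have [r0|r0] := ltP r 0.
  by rewrite ler_nM2r ?invr_lt0// powR_lt0_le.
rewrite ler_pM2r; last by rewrite invr_gt0 lt_neqAle eq_sym rn0.
by apply: ge0_ler_powR; rewrite ?nnegrE// ltW// (lt_le_trans x0).
Qed.

Lemma one_powR x : 1 `^ x = 1 :> R.
Proof. by rewrite powR1. Qed.

Lemma powRK r (x : R) : r != 0 -> 0 <= x -> (x `^ r) `^ r^-1 = x.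
Proof. by move=> r0 x0; rewrite -powRrM mulfV// powRr1. Qed.

Lemma epow_EFin r (x : R) : (r < 0 -> x != 0) -> epow x%:E r = (x `^ r)%:E.
Proof.
by move=> rx /=; case: ifP => // /andP[x0 /rx]; rewrite x0.
Qed.

(** Away from zeros of [p] when r < 0, the extended-real conventions do not
    intervene. *)
Lemma gen_mean_powR r K (p : K.-tuple R) : r != 0 -> (0 < K)%N ->
  unit_cube p -> (r < 0 -> forall k, tnth p k != 0) ->
  gen_mean r%:E p = ((\sum_(k < K) tnth p k `^ r) / K%:R) `^ r^-1.
Proof.
move=> r0 K0 p01 pn0; rewrite /gen_mean (negbTE r0) /epower_mean.
rewrite (eq_bigr (fun k => (tnth p k `^ r)%:E)); last first.
  by move=> k _; rewrite epow_EFin// => rlt0; exact: pn0.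
rewrite sumEFin -EFinM epow_EFin// invr_lt0 => rlt0.
rewrite gt_eqF// divr_gt0 ?ltr0n//.
rewrite (bigD1 (Ordinal K0))//= ltr_pwDl ?sumr_ge0// => [|k _].
  rewrite powR_gt0// lt_neqAle eq_sym pn0//=.
  by have /andP[] := p01 (Ordinal K0).
exact: powR_ge0.
Qed.

Lemma mean_gen_mean_powR r K (p : K.-tuple R) : -1 < r -> r != 0 -> (0 < K)%N ->
  unit_cube p -> (r < 0 -> forall k, tnth p k != 0) ->
  mean_const r%:E * gen_mean r%:E p =
  ((r + 1) * (\sum_(k < K) tnth p k `^ r) / K%:R) `^ r^-1.
Proof.
move=> r1 r0 K0 p01 pn0; rewrite gen_mean_powR//= (negbTE r0) -powRM ?mulrA//.
  by lra.
by rewrite divr_ge0// sumr_ge0// => k _; exact: powR_ge0.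
Qed.

Lemma mean_gen_mean0 K (p : K.-tuple R) : (forall k, 0 < tnth p k) ->
  mean_const 0%:E * gen_mean 0%:E p =
  expR (1 + K%:R^-1 * \sum_(k < K) ln (tnth p k)).
Proof.
move=> p0; rewrite /= eqxx expRD; congr (_ * _).
rewrite mulrC expRM expR_sum; congr (_ `^ _).
by apply: eq_bigr => k _; rewrite lnK// posrE.
Qed.

(** By the mean value theorem each increment [G (k + 2) - G (k + 1)] is a value
    of [g] between [k + 1] and [k + 2]. *)
Lemma sum_le_primitive (g G : R -> R) n :
  (forall x : R, 0 < x -> is_derive x 1 G (g x)) ->
  (forall x y : R, 0 < x -> x <= y -> g x <= g y) ->
  \sum_(k < n) g k.+1%:R <= G n.+1%:R - G 1.
Proof.
move=> dG mg; elim: n => [|n IH]; first by rewrite big_ord0 subrr.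
rewrite big_ord_recr/=.
have n0 : 0 < n.+1%:R :> R by rewrite ltr0n.
have [|||c] := @MVT R G g n.+1%:R n.+2%:R.
- by rewrite ltr_nat.
- move=> x; rewrite in_itv/= => /andP[nx _]; apply: dG; exact: lt_trans nx.
- apply: derivable_within_continuous => x; rewrite in_itv/= => /andP[nx _].
  by have [] := dG x (lt_le_trans n0 nx).
rewrite in_itv/= => /andP[nc _].
have -> : n.+2%:R - n.+1%:R = 1 :> R by rewrite -[n.+2%:R]natr1 addrC addKr.
rewrite mulr1; have := mg _ _ n0 (ltW nc); lra.
Qed.

Lemma sum_ge_primitive (g G : R -> R) n :
  (forall x : R, 0 < x -> is_derive x 1 G (g x)) ->
  (forall x y : R, 0 < x -> x <= y -> g y <= g x) ->
  G n.+1%:R - G 1 <= \sum_(k < n) g k.+1%:R.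
Proof.
move=> dG mg; have := @sum_le_primitive (fun x => - g x) (fun x => - G x) n.
rewrite sumrN -opprD lerN2; apply.
- by move=> x x0; have := dG x x0 => ?; exact: is_deriveN.
- by move=> x y x0 xy; rewrite lerN2 mg.
Qed.

Definition grid K : K.-tuple R := [tuple k.+1%:R / K%:R | k < K].

Lemma grid_gt0 K (k : 'I_K) : 0 < tnth (grid K) k.
Proof.
by rewrite tnth_mktuple divr_gt0// ltr0n// (leq_ltn_trans _ (ltn_ord k)).
Qed.

Lemma grid_cube K : unit_cube (grid K).
Proof.
move=> k; rewrite ltW ?grid_gt0//= tnth_mktuple.
by rewrite ler_pdivrMr ?mul1r ?ler_nat// ltr0n (leq_ltn_trans _ (ltn_ord k)).
Qed.

Lemma is_derive_powR_primitive r x : -1 < r -> 0 < x ->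
  is_derive x 1 (fun x => x `^ (r + 1) / (r + 1)) (x `^ r).
Proof.
move=> r1 x0; have d := is_derive1_powR (r + 1) x0.
have -> : (fun x : R => x `^ (r + 1) / (r + 1)) =
    (fun x : R => (r + 1)^-1 * x `^ (r + 1)).
  by apply/funext => y; rewrite mulrC.
apply: is_derive_eq (is_deriveZ (r + 1)^-1 d) _.
by rewrite addrK scalerA mulVf ?scale1r//; lra.
Qed.

Lemma sum_grid_powR r K : (0 < K)%N -> \sum_(k < K) tnth (grid K) k `^ r =
  (\sum_(k < K) k.+1%:R `^ r) / K%:R `^ r.
Proof.
move=> K0; rewrite mulr_suml; apply: eq_bigr => k _.
rewrite tnth_mktuple powRM// -powRN.
by rewrite -(powR_inv1 (ler0n _ K)) -powRrM mulN1r.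
Qed.

(** The sum of the k^r for k <= K is at most (K + 1)^(r + 1) / (r + 1), so the
    mean of the grid, with its constant, is at most (1 + 1/K)^((r + 1)/r). *)
Lemma grid_mean_pos r a : 0 < r -> 0 < a < 1 -> exists K0, forall K,
  (2 <= K)%N -> (K0 <= K)%N ->
  a * (mean_const r%:E * gen_mean r%:E (grid K)) < 1.
Proof.
move=> r0 /andP[a0 a1].
have r10 : 0 < r + 1 by lra.
(* (1 + 1/K)^((r + 1)/r) < 1/a means 1 + 1/K < b. *)
pose b := a `^ (- r / (r + 1)).
have b1 : 1 < b.
  rewrite /b mulNr powRN -[ltLHS]invr1 ltf_pV2 ?posrE ?powR_gt0//.
  rewrite -[ltRHS](one_powR (r / (r + 1))).
  apply: gt0_ltr_powR; rewrite ?nnegrE//.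
    by rewrite divr_gt0.
  exact: ltW.
exists (Num.bound (b - 1)^-1) => K K2 bK.
have K0 : 0 < K%:R :> R by rewrite ltr0n; exact: leq_trans K2.
have {}bK : 1 + K%:R^-1 < b.
  have : (b - 1)^-1 < K%:R.
    apply: lt_le_trans (archi_boundP _) _; last by rewrite ler_nat.
    by rewrite invr_ge0; lra.
  by rewrite invf_plt ?posrE//; lra.
rewrite mean_gen_mean_powR//; last 5 first.
- by lra.
- by rewrite gt_eqF.
- exact: leq_trans K2.
- exact: grid_cube.
- by lra.
set Y := _ / _.
have Yb : Y < a `^ (- r).
  apply: (@le_lt_trans _ _ ((1 + K%:R^-1) `^ (r + 1))).
    rewrite /Y sum_grid_powR; last exact: leq_trans K2.
    have H : \sum_(k < K) k.+1%:R `^ r <= K.+1%:R `^ (r + 1) / (r + 1).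
      apply: le_trans (@sum_le_primitive (fun x => x `^ r) _ K _ _) _.
      + by move=> x x0; apply: is_derive_powR_primitive; lra.
      + move=> x y x0 xy; apply: ge0_ler_powR; rewrite ?nnegrE//; lra.
      + by rewrite gerBl divr_ge0 ?powR_ge0// ltW.
    have -> : 1 + K%:R^-1 = K.+1%:R / K%:R :> R.
      by rewrite -natr1 mulrDl divff ?mul1r ?gt_eqF.
    have KE : K%:R^-1 `^ (r + 1) = (K%:R `^ r)^-1 / K%:R :> R.
      rewrite -[in LHS](powR_inv1 (ler0n R K)) -powRrM mulN1r powRN.
      rewrite powRD; last by rewrite (gt_eqF K0) implybT.
      by rewrite powRr1// invfM.
    rewrite powRM// ?invr_ge0// KE !mulrA ler_pM2r ?invr_gt0//.
    rewrite ler_pM2r ?invr_gt0 ?powR_gt0//.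
    by rewrite -ler_pdivlMl// mulrC.
  have -> : a `^ (- r) = b `^ (r + 1).
    by rewrite /b -powRrM divfK ?gt_eqF.
  apply: gt0_ltr_powR; rewrite // nnegrE; last by lra.
  by rewrite addr_ge0 ?invr_ge0.
have Y0 : 0 <= Y.
  by rewrite !mulr_ge0 ?invr_ge0 ?sumr_ge0 ?ltW// => k _; exact: powR_ge0.
rewrite -ltr_pdivlMl// mulr1.
have -> : a^-1 = (a `^ (- r)) `^ r^-1.
  by rewrite -powRrM mulNr mulfV ?gt_eqF// powR_inv1// ltW.
by apply: gt0_ltr_powR; rewrite ?nnegrE ?invr_gt0 ?powR_ge0.
Qed.

(** For r < 0 the power 1/r reverses inequalities, so the power sum is now
    bounded from below: it gives (r + 1) times the mean of the (k/K)^r at least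
    1 - K^-(r + 1), which tends to 1 precisely because r > -1. *)
Lemma grid_mean_neg r a : -1 < r -> r < 0 -> 0 < a < 1 -> exists K0, forall K,
  (2 <= K)%N -> (K0 <= K)%N ->
  a * (mean_const r%:E * gen_mean r%:E (grid K)) < 1.
Proof.
move=> r1 r0 /andP[a0 a1].
have r10 : 0 < r + 1 by lra.
pose b := a `^ (- r).
have b1 : b < 1.
  rewrite -[ltRHS](one_powR (- r)); apply: gt0_ltr_powR; rewrite ?nnegrE//.
    by rewrite oppr_gt0.
  exact: ltW.
exists (Num.bound ((1 - b)^-1 `^ (r + 1)^-1)) => K K2 bK.
have K0 : 0 < K%:R :> R by rewrite ltr0n; exact: leq_trans K2.
have {}bK : K%:R `^ (- (r + 1)) < 1 - b.
  have bK' : (1 - b)^-1 `^ (r + 1)^-1 < K%:R.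
    apply: lt_le_trans (archi_boundP _) _; last by rewrite ler_nat.
    exact: powR_ge0.
  rewrite powRN invf_plt ?posrE ?powR_gt0//; last by lra.
  rewrite -[ltLHS](@powRK (r + 1)^-1) ?invr_eq0 ?gt_eqF// ?invrK; last first.
    by rewrite invr_ge0; lra.
  by apply: gt0_ltr_powR; rewrite ?nnegrE ?powR_ge0// ltW.
rewrite mean_gen_mean_powR//; last 4 first.
- by rewrite lt_eqF.
- exact: leq_trans K2.
- exact: grid_cube.
- by move=> _ k; rewrite gt_eqF// grid_gt0.
set Y := _ / _.
have Yb : b < Y.
  apply: (@lt_le_trans _ _ (1 - K%:R `^ (- (r + 1)))); first by lra.
  rewrite /Y sum_grid_powR; last exact: leq_trans K2.
  have H : (K%:R `^ (r + 1) - 1) / (r + 1) <= \sum_(k < K) k.+1%:R `^ r.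
    apply: le_trans _ (@sum_ge_primitive (fun x => x `^ r) _ K _ _);
      last 2 first.
    + by move=> x x0; apply: is_derive_powR_primitive; lra.
    + by move=> x y x0 xy; apply: powR_lt0_le.
    rewrite /= one_powR -mulrBl ler_pM2r ?invr_gt0// lerD2r.
    by apply: ge0_ler_powR; rewrite ?nnegrE ?ler_nat// ltW.
  rewrite [leRHS](_ : _ = (r + 1) * (\sum_(k < K) k.+1%:R `^ r)
      * K%:R `^ (- (r + 1))); last first.
    rewrite powRN (@powRD _ K%:R); last by rewrite (gt_eqF K0) implybT.
    by rewrite powRr1// invfM !mulrA.
  have E : K%:R `^ (r + 1) * K%:R `^ (- (r + 1)) = 1 :> R.
    by rewrite powRN mulfV// gt_eqF// powR_gt0.
  rewrite -[X in X - _]E -[X in _ - X]mul1r -mulrBl ler_pM2r ?powR_gt0//.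
  by rewrite -ler_pdivrMl// mulrC.
rewrite -ltr_pdivlMl// mulr1.
have -> : a^-1 = b `^ r^-1.
  by rewrite -powRrM mulNr mulfV ?lt_eqF// powR_inv1// ltW.
by apply: powR_lt0_lt; rewrite ?invr_lt0 ?powR_gt0.
Qed.

(** The geometric mean of the grid, with its constant, is
    exp(1) (K!)^(1/K) / K. The primitive x ln x - x of ln bounds the logarithm
    of this number by 1/K + ln(K + 1)/K. *)
Lemma grid_mean0 a : 0 < a < 1 -> exists K0, forall K,
  (2 <= K)%N -> (K0 <= K)%N ->
  a * (mean_const 0%:E * gen_mean 0%:E (grid K)) < 1.
Proof.
move=> /andP[a0 a1].
pose e := - ln a / 2.
have e0 : 0 < e by rewrite divr_gt0// oppr_gt0 ln_lt0// a0.
exists (Num.bound ((e - ln e) / e)) => K K2 bK.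
have K0 : 0 < K%:R :> R by rewrite ltr0n; exact: leq_trans K2.
have {}bK : e - ln e < K%:R * e.
  rewrite -ltr_pdivrMr//; apply: lt_le_trans (archi_boundP _) _.
    by rewrite divr_ge0 ?ltW// subr_gt0 ln_sublinear.
  by rewrite ler_nat.
rewrite mean_gen_mean0; last exact: grid_gt0.
rewrite -[a]lnK ?posrE// -expRD -[ltRHS]expR0 ltr_expR.
have aE : ln a = - 2 * e by rewrite /e; field.
suff : 1 + K%:R^-1 * (\sum_(k < K) ln (tnth (grid K) k)) < 2 * e.
  by rewrite aE; lra.
have K10 : 0 < K.+1%:R :> R by [].
have -> : \sum_(k < K) ln (tnth (grid K) k) =
    (\sum_(k < K) ln k.+1%:R) - K%:R * ln K%:R.
  have -> : K%:R * ln K%:R = \sum_(k < K) ln K%:R :> R.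
    by rewrite sumr_const card_ord mulr_natl.
  rewrite -sumrB.
  apply: eq_bigr => k _; rewrite tnth_mktuple lnM ?posrE ?invr_gt0//.
  by rewrite lnV ?posrE.
have H : \sum_(k < K) ln k.+1%:R <= K.+1%:R * ln K.+1%:R - K%:R :> R.
  apply: le_trans (@sum_le_primitive (fun x => ln x)
    (fun x => x * ln x - x) K _ _) _.
  - move=> x x0; have d := is_derive1_ln x0.
    apply: is_derive_eq.
    by rewrite /GRing.scale/= mulr1 mulfV ?gt_eqF//; lra.
  - by move=> x y x0 xy; rewrite ler_ln ?posrE// (lt_le_trans x0).
  - by rewrite ln1 -[X in _ - X - _]natr1; lra.
have l1 : ln K.+1%:R - ln K%:R <= K%:R^-1 :> R.
  rewrite -ln_div ?posrE// -[K.+1%:R]natr1 mulrDl divff ?gt_eqF// mul1r.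
  by rewrite le_ln1Dx// (lt_trans (ltrN10 _))// invr_gt0.
(* ln y <= y - 1 at y = e (K + 1): a linear bound with small slope e. *)
have l2 : ln K.+1%:R <= e * K.+1%:R - 1 - ln e.
  have := @le_ln1Dx R (e * K.+1%:R - 1); rewrite addrCA subrr addr0.
  rewrite lnM ?posrE//.
  have : 0 < e * K.+1%:R by rewrite mulr_gt0.
  lra.
have KV : K%:R * K%:R^-1 = 1 :> R by rewrite mulfV// gt_eqF.
rewrite -(ltr_pM2l K0) mulrDr mulrA KV mul1r mulr1.
move: l1; rewrite -(ler_pM2l K0) KV => l1.
move: H l2; rewrite -natr1 in l1 *; nra.
Qed.

End means.

Lemma grid_mean (R : realType) (r : \bar R) (a : R) : ((-1)%:E < r)%E ->
  0 < a < 1 -> exists K0, forall K, (2 <= K)%N -> (K0 <= K)%N ->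
  a * (mean_const r * gen_mean r (grid R K)) < 1.
Proof.
case: r => [r| |]//; last first.
  move=> _ /andP[a0 a1]; exists 0%N => K _ _; rewrite mul1r.
  apply: le_lt_trans a1; rewrite ler_piMr ?(ltW a0)//.
  by apply: bigmax_le => // k _; have /andP[] := grid_cube R k.
rewrite lte_fin => r1 a01; have [r0|r0|->] := ltgtP r 0.
- exact: grid_mean_neg.
- exact: grid_mean_pos.
- exact: grid_mean0.
Qed.

(** * Monotonicity, symmetry and measurability of the means *)

Section mean_regularity.
Variable R : realType.
Implicit Types (r : R) (K : nat).

Lemma gen_mean_zero r K (p : K.-tuple R) k : r < 0 -> tnth p k = 0 ->
  gen_mean r%:E p = 0.
Proof.
move=> r0 pk; rewrite /gen_mean lt_eqF// /epower_mean.
have K0 : 0 < K%:R^-1 :> R.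
  by rewrite invr_gt0 ltr0n (leq_ltn_trans _ (ltn_ord k)).
have -> : (\sum_(k < K) epow (tnth p k)%:E r = +oo)%E.
  apply/eqP; rewrite esum_eqy.
    by apply/existsP; exists k; rewrite pk /= eqxx r0.
  by move=> i _; rewrite gt_eqF// (lt_le_trans _ (epow_ge0 _ _)).
by rewrite mulyr gtr0_sg// mul1e /= invr_lt0 r0.
Qed.

Lemma gen_mean_ge0 (r : \bar R) K (p : K.-tuple R) : (-oo < r)%E ->
  0 <= gen_mean r p.
Proof.
case: r => [r| |]//= _; last exact: bigmax_ge_id.
by case: ifP => _; [exact: powR_ge0|rewrite fine_ge0// epow_ge0].
Qed.

Lemma mean_const_gt0 (r : \bar R) : ((-1)%:E < r)%E -> 0 < mean_const r.
Proof.
case: r => [r| |]//=; rewrite lte_fin => r1.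
by case: ifP => _; [exact: expR_gt0|rewrite powR_gt0//; lra].
Qed.

Lemma le_gen_mean (r : \bar R) K (p q : K.-tuple R) : ((-1)%:E < r)%E ->
  (0 < K)%N -> unit_cube p -> unit_cube q ->
  (forall k, tnth p k <= tnth q k) -> gen_mean r p <= gen_mean r q.
Proof.
move=> r1 K0 p01 q01 pq.
have p0 k : 0 <= tnth p k by have /andP[] := p01 k.
have q0 k : 0 <= tnth q k by have /andP[] := q01 k.
case: r r1 => [r| |]//= r1; last first.
  apply: bigmax_le => [|k _]; first exact: bigmax_ge_id.
  exact: le_trans (pq k) (le_bigmax _ _ _).
rewrite lte_fin in r1.
have [r0|rn0] := eqVneq r 0.
  apply: ge0_ler_powR; rewrite ?nnegrE ?invr_ge0// ?prodr_ge0//.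
  by apply: ler_prod => k _; rewrite p0 pq.
have fineE (s : K.-tuple R) : fine (epower_mean r s) = gen_mean r%:E s.
  by rewrite /= (negbTE rn0).
rewrite !fineE.
have K0' : 0 < K%:R^-1 :> R by rewrite invr_gt0 ltr0n.
have [rlt0|rge0] := ltP r 0; last first.
  have rN (s : K.-tuple R) : r < 0 -> forall k, tnth s k != 0.
    by rewrite ltNge rge0.
  rewrite (gen_mean_powR rn0 K0 p01 (rN p)) (gen_mean_powR rn0 K0 q01 (rN q)).
  apply: ge0_ler_powR; rewrite ?nnegrE ?invr_ge0//.
  - by rewrite divr_ge0// sumr_ge0// => k _; exact: powR_ge0.
  - by rewrite divr_ge0// sumr_ge0// => k _; exact: powR_ge0.
  - rewrite ler_pM2r//; apply: ler_sum => k _.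
    by apply: ge0_ler_powR; rewrite ?nnegrE.
have [[k pk]|pn0] := pselect (exists k, tnth p k = 0).
  by rewrite (gen_mean_zero rlt0 pk) gen_mean_ge0 ?ltNyr.
have {}pn0 k : 0 < tnth p k.
  by rewrite lt_neqAle eq_sym p0 andbT; apply/eqP => pk; apply: pn0; exists k.
have qn0 k : 0 < tnth q k by exact: lt_le_trans (pq k).
have sum_gt0 (s : K.-tuple R) : (forall k, 0 < tnth s k) ->
    0 < (\sum_(k < K) tnth s k `^ r) / K%:R.
  move=> s0; rewrite mulr_gt0// (bigD1 (Ordinal K0))//=.
  by rewrite ltr_pwDl ?powR_gt0// sumr_ge0// => k _; exact: powR_ge0.
have neq0 (s : K.-tuple R) : (forall k, 0 < tnth s k) ->
    r < 0 -> forall k, tnth s k != 0.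
  by move=> s0 _ k; rewrite gt_eqF.
rewrite (gen_mean_powR rn0 K0 p01 (neq0 _ pn0)).
rewrite (gen_mean_powR rn0 K0 q01 (neq0 _ qn0)).
apply: powR_lt0_le; rewrite ?invr_lt0 ?sum_gt0//.
by rewrite ler_pM2r//; apply: ler_sum => k _; exact: powR_lt0_le.
Qed.

Lemma measurable_unit_cube K : measurable (@unit_cube R K).
Proof.
have -> : @unit_cube R K =
    \big[setI/setT]_(k < K) ((fun p => tnth p k) @^-1` `[0, 1]).
  apply/seteqP; split => p /=.
    by move=> p01; elim/big_ind: _ => // k _; rewrite /= in_itv/= p01.
  by move=> H k; move: H; rewrite (bigD1 k)//= in_itv => -[].
apply: bigsetI_measurable => k _; rewrite -[X in measurable X]setTI.
exact: measurable_tnth.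
Qed.

Lemma measurable_gen_mean (r : \bar R) K : (-oo < r)%E -> (0 < K)%N ->
  measurable_fun (@unit_cube R K) (@gen_mean R r K).
Proof.
case: r => [r| |]// _ K0; last first.
  apply: measurable_funTS; rewrite /gen_mean.
  elim: (index_enum _) => [|k s IH].
    by under eq_fun do rewrite big_nil; exact: measurable_cst.
  under eq_fun do rewrite big_cons.
  by apply: measurable_maxr => //; exact: measurable_tnth.
have [->|rn0] := eqVneq r 0.
  apply: measurable_funTS; rewrite /gen_mean eqxx.
  apply: (measurableT_comp (f := fun x : R => x `^ K%:R^-1)).
    exact: measurable_powR.
  by apply: measurable_prod => k _; exact: measurable_tnth.
(* On the cube the mean agrees with a formula in real numbers only. *)
pose G (p : K.-tuple R) := if (r < 0) && (\prod_(k < K) tnth p k == 0) then 0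
  else ((\sum_(k < K) tnth p k `^ r) / K%:R) `^ r^-1.
apply: (eq_measurable_fun G) => [p|]; first last.
  apply: measurable_funTS; apply: measurable_fun_ifT => //.
    apply: measurable_and => //; apply: measurable_fun_eqr => //.
    by apply: measurable_prod => k _; exact: measurable_tnth.
  apply: (measurableT_comp (f := fun x : R => x `^ r^-1)).
    exact: measurable_powR.
  apply: measurable_funM => //; apply: measurable_sum => k.
  apply: (measurableT_comp (f := fun x : R => x `^ r)).
    exact: measurable_powR.
  exact: measurable_tnth.
rewrite inE => p01; rewrite /G.
case: ifP => [/andP[r0 /prodf_eq0[k _ /eqP pk]]|].
  by rewrite (gen_mean_zero r0 pk).
move=> H; rewrite gen_mean_powR// => r0 k.
apply: contraFN H => /eqP pk; rewrite r0.
by apply/prodf_eq0; exists k => //; apply/eqP.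
Qed.

End mean_regularity.

Lemma gen_mean_rotate (R : realType) (r : \bar R) (K : nat)
    (p : K.+1.-tuple R) (m : 'I_K.+1) :
  gen_mean r [tuple tnth p (m + k) | k < K.+1] = gen_mean r p.
Proof.
rewrite /gen_mean /epower_mean; case: r => [r| |].
- congr (if _ then _ `^ _ else fine (epow (_ * _) _)).
    rewrite [RHS](reindex_inj (addrI m)).
    by apply: eq_bigr => k _; rewrite tnth_mktuple.
  rewrite [RHS](reindex_inj (addrI m)).
  by apply: eq_bigr => k _; rewrite tnth_mktuple.
- rewrite [RHS](reindex_inj (addrI m)).
  by apply: eq_bigr => k _; rewrite tnth_mktuple.
- rewrite [RHS](reindex_inj (addrI m)).
  by apply: eq_bigr => k _; rewrite tnth_mktuple.
Qed.

(** * Duality bounds for arbitrary dependence *)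

(** The integral over [t, e] is H(e) - H(t) <= H(e) for each t > 0, and it
    increases to the integral over ]0, e] as t decreases to 0, whether or not
    [h] is bounded near 0. *)
Lemma integral_oc_primitive_le (R : realType) (h H : R -> R) (e : R) : 0 < e ->
  (forall x : R, 0 < x -> is_derive x 1 H (h x)) ->
  (forall x : R, 0 < x -> derivable h x 1) ->
  (forall x : R, 0 < x <= e -> 0 <= h x) ->
  (forall x : R, 0 < x <= e -> 0 <= H x) ->
  measurable_fun setT h ->
  (\int[lebesgue_measure]_(x in `]0%R, e]) (h x)%:E <= (H e)%:E)%E.
Proof.
move=> e0 dH dh h0 H0 mh.
pose t n : R := e / n.+2%:R.
have t0 n : 0 < t n by rewrite divr_gt0.
have te n : t n < e.
  by rewrite ltr_pdivrMr// ltr_pMr// (ltr_nat R 1).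
pose F n : set R := `[t n, e]%classic.
have EF : `]0, e]%classic = \bigcup_n F n.
  apply/seteqP; split => x /=.
    rewrite in_itv/= => /andP[x0 xe].
    exists (Num.bound (e / x)) => //; rewrite /F/= in_itv/= xe andbT.
    rewrite /t ler_pdivrMr// mulrC -ler_pdivrMr//.
    apply/ltW/(lt_trans (archi_boundP _)); first by rewrite divr_ge0// ltW.
    by rewrite ltr_nat leqnSn.
  move=> [n _]; rewrite /F/= !in_itv/= => /andP[tx ->].
  by rewrite (lt_le_trans (t0 n)).
have intF n : (\int[lebesgue_measure]_(x in F n) (h x)%:E <= (H e)%:E)%E.
  have wcH : {within `[t n, e], continuous H}.
    apply: derivable_within_continuous => x; rewrite in_itv/= => /andP[tx _].
    by have [] := dH x (lt_le_trans (t0 n) tx).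
  rewrite (@continuous_FTC2 _ h H)//; last 3 first.
  - apply: derivable_within_continuous => x; rewrite in_itv/= => /andP[tx _].
    exact: dh (lt_le_trans (t0 n) tx).
  - have /(continuous_within_itvP _ (te n))[_ ? ?] := wcH.
    split => // x; rewrite in_itv/= => /andP[tx _].
    by have [] := dH x (lt_trans (t0 n) tx).
  - move=> x; rewrite in_itv/= => /andP[tx _].
    by rewrite derive1E; have [_ ->] := dH x (lt_trans (t0 n) tx).
  by rewrite -EFinB lee_fin gerBl H0// t0 ltW.
rewrite EF.
have ndF : nondecreasing_seq F.
  move=> m n mn; apply/subsetPset => x; rewrite /F/= !in_itv/=.
  move=> /andP[tx ->]; rewrite andbT (le_trans _ tx)//.
  by rewrite ler_pM2l// lef_pV2 ?posrE// ler_nat !ltnS.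
have cvgF := @ge0_nondecreasing_set_cvg_integral _ (measurableTypeR R) R F
  (EFin \o h)  lebesgue_measure ndF.
have /cvg_lim <- // : (\int[lebesgue_measure]_(x in F n) (EFin \o h) x
    @[n --> \oo] -->
    \int[lebesgue_measure]_(x in \bigcup_i F i) (EFin \o h) x)%E.
  apply: cvgF => [i|i|i x].
  - exact: measurable_itv.
  - by apply/measurable_EFinP; exact: measurable_funTS.
  - rewrite /F/= in_itv/= => /andP[tx xe]; rewrite lee_fin h0// xe andbT.
    exact: lt_le_trans tx.
apply: lime_le; last by apply: nearW => n; exact: intF.
apply/cvg_ex; eexists; apply: cvgF => [i|i|i x].
- exact: measurable_itv.
- by apply/measurable_EFinP; exact: measurable_funTS.
- rewrite /F/= in_itv/= => /andP[tx xe]; rewrite lee_fin h0// xe andbT.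
  exact: lt_le_trans tx.
Qed.

Lemma expectation_uniform d (T : measurableType d) (R : realType)
    (P : probability T R) (U : {RV P >-> R}) (h : R -> \bar R) :
  uniform_rv U -> measurable_fun setT h -> (forall x, 0 <= h x)%E ->
  (\int[P]_w h (U w) = \int[lebesgue_measure]_(x in `[0%R, 1%R]) h x)%E.
Proof.
move=> [_ uU] mh h0.
rewrite -[LHS](ge0_integral_distribution (borel_rv U) mh h0).
rewrite (eq_measure_integral (uniform_prob (@ltr01 R))); last first.
  by move=> A mA _; exact: uU.
by rewrite integral_uniform// subr0 invr1 mul1e.
Qed.

(** Linearity of expectation does not see the dependence between the [U k]:
    integrating the pointwise bound over the event gives
    K P(F(U) <= e) <= K e. *)
Lemma prob_le_dual d (T : measurableType d) (R : realType) (P : probability T R)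
    K (F : K.-tuple R -> R) (h : R -> \bar R) (e : R)
    (U : 'I_K -> {RV P >-> R}) : (0 < K)%N ->
  measurable_fun (@unit_cube R K) F -> (forall k, uniform_rv (U k)) ->
  measurable_fun setT h -> (forall x, 0 <= h x)%E ->
  (\int[lebesgue_measure]_(x in `[0%R, 1%R]) h x <= e%:E)%E ->
  (forall p, unit_cube p -> F p <= e ->
    (K%:R%:E <= \sum_(k < K) h (tnth p k))%E) ->
  (P [set w | (F [tuple U k w | k < K] <= e)%R] <= e%:E)%E.
Proof.
move=> K0 mF uU mh h0 he hF.
have cubeU w : unit_cube [tuple U k w | k < K].
  by move=> k; rewrite tnth_mktuple; have [] := uU k.
have mFU : measurable_fun setT (fun w => F [tuple U k w | k < K]).
  apply: (measurable_comp (F := @unit_cube R K)) => //.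
  - exact: measurable_unit_cube.
  - by move=> _ [w _ <-]; exact: cubeU.
  - apply/measurable_fun_tnthP => k.
    apply: (eq_measurable_fun (U k)); last exact: measurable_funPT.
    by move=> w _ /=; rewrite tnth_mktuple.
set A := [set w | _].
have mA : measurable A.
  rewrite [X in measurable X](_ : _ =
    setT `&` (fun w => F [tuple U k w | k < K]) @^-1` `]-oo, e]);
    first exact: mFU.
  by rewrite setTI; apply/seteqP; split => w /=; rewrite in_itv.
have mhU k : measurable_fun setT (fun w => h (U k w)).
  by apply: (measurableT_comp mh); exact: measurable_funPT.
rewrite -(@lee_pmul2l _ K%:R%:E) ?lte_fin ?ltr0n//.
rewrite -integral_cst//.
apply: (@le_trans _ _ (\int[P]_(w in A) \sum_(k < K) h (U k w))%E).
  apply: ge0_le_integral => //.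
  - by move=> w _; rewrite lee_fin.
  - by apply: emeasurable_sum => k; apply: measurable_funTS; exact: mhU.
  - move=> w /= /(hF _ (cubeU w)) /le_trans; apply.
    by apply: lee_sum => k _; rewrite tnth_mktuple.
apply: (@le_trans _ _ (\int[P]_w \sum_(k < K) h (U k w))%E).
  apply: ge0_subset_integral => //; first by apply: emeasurable_sum.
  by move=> w _; apply: sume_ge0.
rewrite ge0_integral_sum//.
apply: (@le_trans _ _ (\sum_(k < K) e%:E)%E).
  by apply: lee_sum => k _; rewrite expectation_uniform.
by rewrite sumEFin sumr_const card_ord -EFinM mulr_natl.
Qed.

(** [h] is nonnegative up to [e] and nonpositive beyond, so truncating it to 0
    beyond [e] only helps the pointwise bound; the value +oo at 0, where [F] may vanish
    without [h] being defined, costs nothing in the integral. *)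
Lemma prob_le_primitive d (T : measurableType d) (R : realType)
    (P : probability T R) K (F : K.-tuple R -> R) (h H : R -> R) (e : R)
    (U : 'I_K -> {RV P >-> R}) : (0 < K)%N -> 0 < e < 1 ->
  measurable_fun (@unit_cube R K) F -> (forall k, uniform_rv (U k)) ->
  measurable_fun setT h ->
  (forall x : R, 0 < x -> is_derive x 1 H (h x)) ->
  (forall x : R, 0 < x -> derivable h x 1) ->
  (forall x : R, 0 < x <= e -> 0 <= h x) ->
  (forall x : R, 0 < x <= e -> 0 <= H x) ->
  (forall x : R, e < x -> h x <= 0) ->
  H e = e ->
  (forall p, unit_cube p -> (forall k, 0 < tnth p k) -> F p <= e ->
    K%:R <= \sum_(k < K) h (tnth p k)) ->
  (P [set w | (F [tuple U k w | k < K] <= e)%R] <= e%:E)%E.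
Proof.
move=> K0 /andP[e0 e1] mF uU mh dH dh h0 H0 hle0 He hF.
pose g (x : R) : \bar R :=
  if x <= 0 then +oo%E else if x <= e then (h x)%:E else 0%E.
have g0 x : (0 <= g x)%E.
  rewrite /g; case: (leP x 0) => // x0; case: (leP x e) => // xe.
  by rewrite lee_fin h0// x0.
have mg : measurable_fun setT g.
  apply: measurable_fun_ifT => //; first exact: measurable_fun_ler.
  apply: measurable_fun_ifT => //; first exact: measurable_fun_ler.
  exact/measurable_EFinP.
apply: (@prob_le_dual _ _ _ _ _ _ g) => //.
  rewrite -integral_itv_obnd_cbnd; last exact: measurable_funTS.
  have -> : (\int[lebesgue_measure]_(x in `]0%R, 1%R]) g x =
      \int[lebesgue_measure]_(x in `]0%R, 1%R])
        ((fun x => (h x)%:E) \_ `]0%R, e]) x)%E.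
    apply: eq_integral => x; rewrite inE/= in_itv/= => /andP[x0 _].
    rewrite patchE /g leNgt x0/=; case: ifPn => xe.
      by rewrite mem_set//= in_itv/= x0.
    by rewrite memNset//= in_itv/= x0/= (negbTE xe).
  rewrite -integral_mkcondr (_ : _ `&` _ = `]0, e]%classic); last first.
    apply/seteqP; split => x /=; rewrite !in_itv/=; first by move=> [].
    by move=> /andP[-> xe]; rewrite xe (le_trans xe)// ltW.
  by have := integral_oc_primitive_le e0 dH dh h0 H0 mh; rewrite He.
move=> p p01 Fpe.
have [pgt0|] := pselect (forall k, 0 < tnth p k).
  apply: (@le_trans _ _ (\sum_(k < K) (h (tnth p k))%:E)%E).
    by rewrite sumEFin lee_fin hF.
  apply: lee_sum => k _; rewrite /g [tnth p k <= 0]leNgt pgt0/=.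
  case: (leP (tnth p k) e) => // ek.
  by rewrite lee_fin hle0.
move=> /existsNP[k /negP]; rewrite -leNgt => pk.
rewrite (bigD1 k)//= {1}/g pk addye ?leey//.
by rewrite gt_eqF// (lt_le_trans _ (sume_ge0 _ _)).
Qed.

(** * The means with their constants are merging *)

Section mean_bounds.
Context d (T : measurableType d) (R : realType) (P : probability T R).
Variables (K : nat) (e : R) (U : 'I_K -> {RV P >-> R}).
Hypotheses (K0 : (0 < K)%N) (e01 : 0 < e < 1).
Hypothesis uU : forall k, uniform_rv (U k).

Let e0 : 0 < e. Proof. by case/andP: e01. Qed.

Let measurable_F (r : \bar R) : (-oo < r)%E ->
  measurable_fun (@unit_cube R K) (fun p => mean_const r * gen_mean r p).
Proof.
by move=> r0; apply: measurable_funM => //; exact: measurable_gen_mean.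
Qed.

(** Dividing by r makes u^r/r increasing for both signs of r. With c = e^-r, the
    dual function is [h], positive exactly below e, and the sum of the h(p_k) is
    K ((r + 1)/r - c Y/r) with Y the r-th power of the weighted mean; it
    reaches K at the extreme value Y = e^r. *)
Lemma power_mean_bound (r : R) : -1 < r -> r != 0 ->
  (P [set w | (mean_const r%:E * gen_mean r%:E [tuple U k w | k < K] <= e)%R]
    <= e%:E)%E.
Proof.
move=> r1 rn0; have r10 : 0 < r + 1 by lra.
pose c := e `^ (- r).
have ec : e `^ r * c = 1 by rewrite /c powRN mulfV// gt_eqF// powR_gt0.
have c0 : 0 < c by rewrite powR_gt0.
pose h (x : R) := (r + 1) * (r^-1 - c * (x `^ r / r)).
pose H (x : R) := (r + 1) / r * (x - c * (x `^ (r + 1) / (r + 1))).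
have xr1 (x : R) : 0 < x -> x `^ (r + 1) = x `^ r * x.
  move=> x0; rewrite powRD ?powRr1 ?(ltW x0)//.
  by rewrite (gt_eqF x0) implybT.
have rV : r^-1 = c * (e `^ r / r) by rewrite mulrA [c * _]mulrC ec mul1r.
have h0 (x : R) : 0 < x <= e -> 0 <= h x.
  move=> /andP[x0 xe]; rewrite /h [X in _ * (X - _)]rV.
  rewrite mulr_ge0 ?(ltW r10)// subr_ge0.
  by rewrite ler_pM2l// powR_div_le.
refine (@prob_le_primitive _ _ _ P K
  (fun p => mean_const r%:E * gen_mean r%:E p) h H e U K0 e01
  (measurable_F (ltNyr _)) uU _ _ _ _ _ _ _ _).
- apply: measurable_funM => //; apply: measurable_funB => //.
  by do 2 apply: measurable_funM => //.
- move=> x x0; have dx := is_derive_powR_primitive r1 x0.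
  rewrite /H; apply: is_derive_eq.
  rewrite /GRing.scale/= /h; field; rewrite rn0/=; lra.
- move=> x x0; rewrite /h.
  have dx := @is_derive1_powR _ r x x0.
  by apply: ex_derive.
- exact: h0.
- move=> x /[dup] xe /andP[x0 _].
  have -> : H x = x * (h x / (r + 1) + 1).
    by rewrite /H /h xr1//; field; rewrite rn0/=; lra.
  rewrite mulr_ge0 ?(ltW x0)// addr_ge0// divr_ge0 ?h0//; exact: ltW.
- move=> x ex; rewrite /h [X in _ * (X - _)]rV pmulr_rle0// subr_le0 ler_pM2l//.
  by rewrite powR_div_le// ltW.
- rewrite /H xr1// mulrA [c * _]mulrA [c * _]mulrC ec; field.
  by rewrite rn0/=; lra.
- move=> p p01 p0; rewrite mean_gen_mean_powR//; last first.
    by move=> _ k; rewrite gt_eqF.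
  set S := \sum_(k < K) _; set Y := _ / _ => Ye.
  have KR : 0 < K%:R :> R by rewrite ltr0n.
  have S0 : 0 < S.
    rewrite /S (bigD1 (Ordinal K0))//= ltr_pwDl ?powR_gt0//.
    by rewrite sumr_ge0// => k _; exact: powR_ge0.
  have Y0 : 0 < Y by rewrite divr_gt0// mulr_gt0.
  have Yr : c * (Y / r) <= r^-1.
    rewrite [leRHS]rV ler_pM2l//.
    have := @powR_div_le R r (Y `^ r^-1) e rn0 (powR_gt0 _ Y0) Ye.
    by rewrite -[in X in X -> _]powRrM mulVf// powRr1// ltW.
  have -> : \sum_(k < K) h (tnth p k) = (r + 1) * (K%:R / r - c * (S / r)).
    rewrite -mulr_sumr sumrB sumr_const card_ord -mulr_sumr -mulr_suml.
    by rewrite mulr_natl.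
  have -> : S = Y * K%:R / (r + 1).
    by rewrite /Y; field; rewrite !gt_eqF.
  have -> : (r + 1) * (K%:R / r - c * (Y * K%:R / (r + 1) / r)) =
      K%:R * ((r + 1) / r - c * (Y / r)) by field; rewrite rn0/=; lra.
  rewrite ler_pMr//.
  have : (r + 1) / r = 1 + r^-1 by field.
  lra.
Qed.

Lemma geometric_mean_bound :
  (P [set w | (mean_const 0%:E * gen_mean 0%:E [tuple U k w | k < K] <= e)%R]
    <= e%:E)%E.
Proof.
pose h (x : R) := ln e - ln x.
pose H (x : R) := x * ln e - (x * ln x - x).
refine (@prob_le_primitive _ _ _ P K
  (fun p => mean_const 0%:E * gen_mean 0%:E p) h H e U K0 e01
  (measurable_F (ltNyr _)) uU _ _ _ _ _ _ _ _).
- by apply: measurable_funB => //; exact: measurable_ln.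
- move=> x x0; have dx := is_derive1_ln x0.
  rewrite /H; apply: is_derive_eq.
  by rewrite /GRing.scale/= /h mulr1 mulfV ?gt_eqF//; lra.
- move=> x x0; have dx := is_derive1_ln x0.
  by rewrite /h; apply: ex_derive.
- by move=> x /andP[x0 xe]; rewrite subr_ge0 ler_ln ?posrE.
- move=> x /andP[x0 xe].
  have -> : H x = x * (ln e - ln x + 1) by rewrite /H; lra.
  by rewrite mulr_ge0 ?(ltW x0)// addr_ge0// subr_ge0 ler_ln ?posrE.
- move=> x ex; have x0 := lt_trans e0 ex.
  by rewrite subr_le0 ler_ln ?posrE//; exact: ltW.
- by rewrite /H; lra.
- move=> p p01 p0; rewrite mean_gen_mean0//.
  rewrite -[X in _ <= X](lnK e0) ler_expR => Fe.
  have KR : 0 < K%:R :> R by rewrite ltr0n.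
  rewrite sumrB sumr_const card_ord -mulr_natl.
  move: Fe; rewrite -(ler_pM2l KR) mulrDr mulrA mulfV ?gt_eqF//.
  lra.
Qed.

Lemma max_bound :
  (P [set w | (mean_const +oo%E * gen_mean +oo%E [tuple U k w | k < K] <= e)%R]
    <= e%:E)%E.
Proof.
pose h (x : R) : \bar R := (\1_`]-oo, e] x)%:E.
refine (@prob_le_dual _ _ _ P K (fun p => mean_const +oo%E * gen_mean +oo%E p)
  h e U K0 (measurable_F (isT : (-oo < +oo :> \bar R)%E)) uU _ _ _ _).
- exact/measurable_EFinP/measurable_indic.
- by move=> x; rewrite /h lee_fin.
- rewrite /h integral_indic//.
  rewrite (_ : _ `&` _ = `[0, e]%classic); last first.
    apply/seteqP; split => x /=; rewrite !in_itv/=.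
      by move=> [-> /andP[->]].
    move=> /andP[x0 xe]; rewrite x0 xe (le_trans xe)// ltW//.
    by case/andP: e01.
  have := lebesgue_measure_itv `[0, e]; rewrite /= lte_fin e0 oppr0 adde0.
  by move=> muE; rewrite [leLHS]muE.
- move=> p p01; rewrite mul1r => pe.
  rewrite /h sumEFin lee_fin (eq_bigr (fun=> 1)); last first.
    move=> k _; rewrite indicE mem_set//= in_itv/=.
    exact: le_trans (le_bigmax _ _ _) pe.
  by rewrite sumr_const card_ord.
Qed.

End mean_bounds.

(** * The proposition *)

Theorem proposition3 (R : realType) (d : measure_display)
    (T : measurableType d) (P : probability T R) (hP : atomless P)
    (r : \bar R) (hr : ((-1)%:E < r)%E) :
  (forall K : nat, (2 <= K)%N ->
     merging P (fun p : K.-tuple R => mean_const r * gen_mean r p)) /\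
  asymptotically_precise P
    (fun (K : nat) (p : K.-tuple R) => mean_const r * gen_mean r p).
Proof.
have rNy : (-oo < r)%E by exact: lt_trans (ltNyr _) hr.
have c0 := mean_const_gt0 hr.
split => [K K2|a a01].
  have K0 : (0 < K)%N by exact: leq_trans K2.
  split.
  - by move=> p _; rewrite mulr_ge0 ?(ltW c0)// gen_mean_ge0.
  - by apply: measurable_funM => //; exact: measurable_gen_mean.
  - move=> p q k p01 q01 pq pqk; rewrite ler_pM2l//.
    apply: le_gen_mean => // j.
    by have [->//|jk] := eqVneq j k; rewrite pq.
  - move=> e e01; apply: ge_ereal_sup => _ [U /= uU <-].
    case: r hr {rNy c0} => [r| |]// hr; last exact: max_bound.
    have [->|r0] := eqVneq r 0; first exact: geometric_mean_bound.
    by apply: power_mean_bound => //; rewrite lte_fin in hr.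
have [K0 grid_lt1] := grid_mean hr a01; exists K0 => -[//|K] K2 K0K.
set F := fun _ => _.
move=> [_ _ _ bound].
have [V uV] := atomless_uniform_rv hP.
have [U uU Ugrid] := uniform_rv_grid K uV.
case/andP: a01 => a0 _.
(* The maximum with 1/2 only ensures that e > 0. *)
pose e := Num.max (a * (mean_const r * gen_mean r (grid R K.+1))) 2^-1.
have e01 : 0 < e < 1.
  by rewrite lt_max gt_max grid_lt1// invr_gt0 ltr0n orbT/= invf_lt1 ?ltr1n.
have : (1%:E <= e%:E)%E.
  apply: le_trans (bound e e01); apply: ereal_sup_ubound.
  exists U; first exact: uU.
  rewrite (_ : [set w | _] = setT) ?probability_setT//.
  apply/seteqP; split => // w _ /=; rewrite /F.
  rewrite le_max; apply/orP; left; rewrite !ler_pM2l//.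
  have [m Um] := Ugrid w.
  rewrite -(gen_mean_rotate r (grid R K.+1) m); apply: le_gen_mean => // k.
  - by rewrite tnth_mktuple; have [] := uU k.
  - by rewrite tnth_mktuple; exact: grid_cube.
  - by rewrite !tnth_mktuple.
by rewrite lee_fin leNgt; case/andP: e01 => _ ->.
Qed.
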